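(* Let $S$ be a semigroup and $\rho$ a congruence on $S$. For each $K\in\{L,R,J\}$, if $S$ satisfies $M_K$ then so does the quotient semigroup $S/\rho$.
   Context: For a semigroup $S$, $S^1$ denotes the monoid obtained from $S$ by adjoining a new identity $1$. Green's preorders on $S$ are $a\leq_{\mathcal L}b\Leftrightarrow S^1a\subseteq S^1b$, $a\leq_{\mathcal R}b\Leftrightarrow aS^1\subseteq bS^1$, $a\leq_{\mathcal J}b\Leftrightarrow S^1aS^1\subseteq S^1bS^1$. Each induces an equivalence relation ($\mathcal L$, $\mathcal R$, $\mathcal J$ respectively) and a partial order on the set of its classes. A semigroup satisfies $M_L$ (resp. $M_R$, $M_J$) if every non-empty set of $\mathcal L$-classes (resp. $\mathcal R$-classes, $\mathcal J$-classes) contains a minimal member. A congruence on $S$ is an equivalence relation compatible with left and right multiplication. *)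

(* Defs.v *)
From HB Require Import structures.
From mathcomp Require Import all_boot.
From mathcomp Require Import boolp classical_sets.

Set Implicit Arguments.
Unset Strict Implicit.
Unset Printing Implicit Defensive.

Local Open Scope classical_set_scope.
Local Open Scope group_scope.
Local Open Scope quotient_scope.

(* S^1: None is the new identity, adjoined even when S already has one. *)
Definition adjoin1 (S : semigroupType) : Type := option S.

Section Adjoin1.
Variable S : semigroupType.

HB.instance Definition _ := Choice.copy (adjoin1 S) (option S).

Definition adjoin1_mul (x y : adjoin1 S) : adjoin1 S :=
  match x, y with
  | None, _ => y
  | _, None => x
  | Some a, Some b => Some (a * b)
  end.

Fact adjoin1_mulA : associative adjoin1_mul.
Proof. by move=> [a|] [b|] [c|] //=; rewrite mulgA. Qed.

Fact adjoin1_mul1 : left_id None adjoin1_mul.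
Proof. by case. Qed.

Fact adjoin1_mulr1 : right_id None adjoin1_mul.
Proof. by case. Qed.

HB.instance Definition _ :=
  isMonoid.Build (adjoin1 S) adjoin1_mulA adjoin1_mul1 adjoin1_mulr1.

Definition to_adjoin1 (a : S) : adjoin1 S := Some a.

End Adjoin1.

Variant green_kind := GreenL | GreenR | GreenJ.

Section Green.
Variables (K : green_kind) (S : semigroupType).
Implicit Types (a b : S) (A B : set S) (C : set (set S)).

(* S^1 a, a S^1 and S^1 a S^1, as subsets of S^1. *)
Definition principal_ideal a : set (adjoin1 S) :=
  match K with
  | GreenL => [set x * to_adjoin1 a | x in [set: adjoin1 S]]
  | GreenR => [set to_adjoin1 a * y | y in [set: adjoin1 S]]
  | GreenJ => [set x * to_adjoin1 a * y | x in [set: adjoin1 S] &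
                                          y in [set: adjoin1 S]]
  end.

Definition green_le a b : Prop := principal_ideal a `<=` principal_ideal b.

Definition green_equiv a b : Prop := green_le a b /\ green_le b a.

Definition green_class a : set S := [set b | green_equiv a b].

Definition green_classes : set (set S) := range green_class.

(* On green_classes this does not depend on the representatives a and b. *)
Definition green_class_le A B : Prop :=
  exists a b, [/\ A a, B b & green_le a b].

Definition min_condition : Prop :=
  forall C, C `<=` green_classes -> C !=set0 ->
    exists2 A, C A & forall B, C B -> green_class_le B A -> B = A.

End Green.

Record congruence (S : semigroupType) := Congruence {
  congruence_rel :> S -> S -> Prop;
  congruence_refl : forall a, congruence_rel a a;
  congruence_sym : forall a b, congruence_rel a b -> congruence_rel b a;
  congruence_trans : forall a b c,
    congruence_rel a b -> congruence_rel b c -> congruence_rel a c;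
  congruence_mull : forall c a b,
    congruence_rel a b -> congruence_rel (c * a) (c * b);
  congruence_mulr : forall c a b,
    congruence_rel a b -> congruence_rel (a * c) (b * c)
}.

Section Quotient.
Variables (S : semigroupType) (rho : congruence S).

Definition congruenceb : rel S := fun a b => `[< rho a b >].

Fact congruenceb_refl : reflexive congruenceb.
Proof. by move=> a; apply/asboolP/congruence_refl. Qed.

Fact congruenceb_sym : symmetric congruenceb.
Proof. by move=> a b; apply/asboolP/asboolP; apply: congruence_sym. Qed.

Fact congruenceb_trans : transitive congruenceb.
Proof.
by move=> b a c /asboolP ab /asboolP bc; apply/asboolP/(congruence_trans ab).
Qed.

Canonical congruenceb_equiv :=
  EquivRel congruenceb congruenceb_refl congruenceb_sym congruenceb_trans.

Definition quotient_semigroup := {eq_quot congruenceb_equiv}.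

HB.instance Definition _ := Choice.on quotient_semigroup.
HB.instance Definition _ := EqQuotient.on quotient_semigroup.

Fact quotient_piP (a b : S) :
  \pi_quotient_semigroup a = \pi_quotient_semigroup b <-> rho a b.
Proof.
by split=> [/eqmodP/asboolP|ab]; last by apply/eqmodP/asboolP.
Qed.

Definition quotient_mul := lift_op2 quotient_semigroup (@mul S).

Fact quotient_pi_mul :
  {morph \pi_quotient_semigroup : a b / a * b >-> quotient_mul a b}.
Proof.
move=> a b; unlock quotient_mul; apply/quotient_piP.
have ra : rho a (repr (\pi_quotient_semigroup a)).
  by apply/quotient_piP; rewrite reprK.
have rb : rho b (repr (\pi_quotient_semigroup b)).
  by apply/quotient_piP; rewrite reprK.
exact: congruence_trans (congruence_mulr b ra) (congruence_mull _ rb).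
Qed.

Fact quotient_mulA : associative quotient_mul.
Proof.
move=> x y z; rewrite -[x]reprK -[y]reprK -[z]reprK.
by rewrite -!quotient_pi_mul mulgA.
Qed.

HB.instance Definition _ :=
  isSemigroup.Build quotient_semigroup quotient_mulA.

End Quotient.

(* Main.v *)
Require Import Defs.
From mathcomp Require Import all_boot.
From mathcomp Require Import classical_sets.

(** The projection [pi : S -> S/rho] is monotone for Green's preorders, and
    principal ideals lift: if [u <= pi b] then [u = pi a] for some [a <= b].
    Given a set [C] of classes of [S/rho], choose a minimal class, that of [a],
    among the classes of the elements of [S] that [pi] sends into a member of
    [C]. A class of [C] below that of [pi a] is the class of [pi c] for some
    [c <= a]; minimality gives [a <= c], hence [pi a <= pi c]. *)

Set Implicit Arguments.
Unset Strict Implicit.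
Unset Printing Implicit Defensive.

Local Open Scope classical_set_scope.
Local Open Scope group_scope.
Local Open Scope quotient_scope.

Section GreenTheory.
Variables (K : green_kind) (S : semigroupType).
Implicit Types (a b c : S).

Lemma green_le_refl a : green_le K a a.
Proof. exact: subset_refl. Qed.

Lemma green_le_trans a b c : green_le K a b -> green_le K b c -> green_le K a c.
Proof. exact: subset_trans. Qed.

(** A uniform description of the three preorders: [K] only decides which multiplier must be [1], so
    later arguments need no case analysis on [K]. *)
Lemma green_leP a b :
  green_le K a b <-> exists x y : adjoin1 S,
    [/\ K = GreenR -> x = 1, K = GreenL -> y = 1
      & to_adjoin1 a = x * to_adjoin1 b * y].
Proof.
rewrite /green_le; case: K => /=; split.
(* In each case, the inclusion is needed only at [a] itself, which lies in its own ideal;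
   conversely, multipliers compose by associativity. *)
- move=> /(_ (to_adjoin1 a)) [|x _ xb]; first by exists 1; rewrite ?mul1g.
  by exists x, 1; rewrite mulg1; split.
- move=> [x [y [_ -> // ->]]] _ [z _ <-]; rewrite mulg1.
  by exists (z * x) => //; rewrite mulgA.
- move=> /(_ (to_adjoin1 a)) [|y _ yb]; first by exists 1; rewrite ?mulg1.
  by exists 1, y; rewrite mul1g; split.
- move=> [x [y [-> // _ ->]]] _ [z _ <-]; rewrite mul1g.
  by exists (y * z) => //; rewrite mulgA.
- move=> /(_ (to_adjoin1 a)) [|x _ [y _ xy]].
    by exists 1 => //; exists 1; rewrite ?mul1g ?mulg1.
  by exists x, y; split.
- move=> [x [y [_ _ ->]]] _ [z _ [t _ <-]].
  by exists (z * x) => //; exists (y * t) => //; rewrite !mulgA.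
Qed.

Lemma green_class_eqP a b :
  green_class K a = green_class K b <-> green_equiv K a b.
Proof.
split=> [eq_ab | [ab ba]].
  have: green_class K b b by split; apply: green_le_refl.
  by rewrite -eq_ab.
apply/seteqP; split=> c [le1 le2].
  by split; [apply: green_le_trans le1 | apply: green_le_trans ab].
by split; [apply: green_le_trans le1 | apply: green_le_trans ba].
Qed.

Lemma green_class_leP a b :
  green_class_le K (green_class K a) (green_class K b) <-> green_le K a b.
Proof.
split=> [[c [d [[ac _] [_ db] cd]]] | ab].
  exact: green_le_trans ac (green_le_trans cd db).
by exists a, b; split => //; split; apply: green_le_refl.
Qed.

End GreenTheory.

Section QuotientGreen.
Variables (S : semigroupType) (rho : congruence S).
Let Q : semigroupType := quotient_semigroup rho.
Let pi (a : S) : Q := \pi_(quotient_semigroup rho) a.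

(** As [pi1] fixes the adjoined identity, the side conditions of [green_leP] pass to the
    quotient. *)
Let pi1 (x : adjoin1 S) : adjoin1 Q := omap pi x.

Let pi1M x y : pi1 (x * y) = pi1 x * pi1 y.
Proof.
by case: x y => [a|] [b|] //; congr Some; apply: quotient_pi_mul.
Qed.

Let reprK_pi (u : Q) : pi (repr u) = u.
Proof. exact: reprK. Qed.

Let pi1_surj (x : adjoin1 Q) : pi1 (omap repr x) = x.
Proof. by case: x => //= u; rewrite reprK_pi. Qed.

Lemma green_le_pi K a b : green_le K a b -> green_le K (pi a) (pi b).
Proof.
move=> /green_leP [x [y [xK yK /(congr1 pi1)]]]; rewrite !pi1M => e.
by apply/green_leP; exists (pi1 x), (pi1 y); split=> // [/xK|/yK] ->.
Qed.

(** Representatives of the multipliers of [pi b], with [1] lifted to [1], multiply [b] to the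
    required [a]. *)
Lemma green_le_lift K u b :
  green_le K u (pi b) -> exists2 a, green_le K a b & pi a = u.
Proof.
move=> /green_leP [x [y [xK yK e]]].
pose x' : adjoin1 S := omap repr x; pose y' : adjoin1 S := omap repr y.
(* The middle factor lies in [S], so the product is never the adjoined identity. *)
have [a ea] : exists a, to_adjoin1 a = x' * to_adjoin1 b * y'.
  by case: x' y' => [c|] [d|]; eexists; reflexivity.
exists a.
  apply/green_leP; exists x', y'; split=> // [/xK|/yK] eK.
    by rewrite /x' eK.
  by rewrite /y' eK.
have := congr1 pi1 ea; rewrite !pi1M !pi1_surj.
by rewrite -[pi1 (to_adjoin1 b)]/(to_adjoin1 (pi b)) -e => -[].
Qed.

End QuotientGreen.

Theorem corollary4p3 (S : semigroupType) (rho : congruence S)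
    (K : green_kind) :
  min_condition K S -> min_condition K (quotient_semigroup rho).
Proof.
move=> minS C Cclass [A0 CA0].
pose pi (a : S) : quotient_semigroup rho := \pi_(quotient_semigroup rho) a.
pose D := [set green_class K a | a in [set a | C (green_class K (pi a))]].
have [||A [a /= Ca <-] minA] := minS D.
- by move=> _ [a _ <-]; exists a.
- have [u _ eA0] := Cclass _ CA0; exists (green_class K (repr u)).
  by exists (repr u) => //=; rewrite /pi reprK eA0.
exists (green_class K (pi a)) => // B CB.
have [u _ eB] := Cclass _ CB; rewrite -eB in CB *.
move=> /green_class_leP le_ua; have [c le_ca eu] := green_le_lift le_ua.
have /green_class_eqP [_ le_ac] : green_class K c = green_class K a.
  (* The class of [c] lies in [D]: [pi c = u], and the class of [u] belongs to [C]. *)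
  apply: minA; last exact/green_class_leP.
  by exists c => //=; rewrite /pi eu.
apply/green_class_eqP; split=> //; rewrite -eu.
exact: green_le_pi.
Qed.
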